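(* Let $0<q<1$, let $X, X_0, X_1, X_2,\ldots$ be almost surely non-negative i.i.d. random variables with $\mathbb{E}\log\max(X,1)<\infty$, and let $S=\sum_{n=0}^\infty q^n X_n$. Let $-\log \mathbb{P}(X \leq \varepsilon) \sim K \varepsilon^{-\gamma}$, as $\varepsilon\to 0$, for some $\gamma>0$ and $K>0$. Then $$-\log \mathbb{P}(S \leq \varepsilon) \sim \frac{K}{\left(1-q^{\gamma/(1+\gamma)}\right)^{1+\gamma}}\, \varepsilon^{-\gamma},\qquad \text{as } \varepsilon\to 0.$$
   Context: Here $\varepsilon\to 0$ means $\varepsilon\downarrow 0$ through positive values, and $f\sim g$ means $\lim f/g=1$. The condition $\mathbb{E}\log\max(X,1)<\infty$ is the necessary and sufficient condition for $S<\infty$ almost surely. *)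

(* Defs.v *)
From HB Require Import structures.
From mathcomp Require Import all_boot all_order all_algebra finmap.
From mathcomp Require Import all_classical all_reals all_analysis.

Set Implicit Arguments.
Unset Strict Implicit.
Unset Printing Implicit Defensive.

Import Order.TTheory GRing.Theory Num.Theory.
Import numFieldNormedType.Exports.

Local Open Scope classical_set_scope.
Local Open Scope ring_scope.
Local Open Scope ereal_scope.

Definition mutually_independent d (T : measurableType d) (R : realType)
    (P : probability T R) (I : choiceType) (Y : I -> {RV P >-> R}) : Prop :=
  forall (J : {fset I}) (A : I -> set R), (forall i, measurable (A i)) ->
    P (\bigcap_(i in [set` J]) (Y i @^-1` A i)) =
    \prod_(i <- J) P (Y i @^-1` A i).

Definition identically_distributed d (T : measurableType d) (R : realType)
    (P : probability T R) (I : Type) (Y : I -> {RV P >-> R}) : Prop :=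
  forall (i j : I) (A : set R), measurable A ->
    distribution P (Y i) A = distribution P (Y j) A.

Definition iid d (T : measurableType d) (R : realType)
    (P : probability T R) (I : choiceType) (Y : I -> {RV P >-> R}) : Prop :=
  mutually_independent Y /\ identically_distributed Y.

(* The sum lives in \bar R so that a divergent series of non-negative terms has
   value +oo. The limit is a default value where the partial sums
   have no limit in \bar R, which for almost surely non-negative X n only
   happens on a null set. *)
Definition geometric_series d (T : measurableType d) (R : realType)
    (P : probability T R) (q : R) (X : nat -> {RV P >-> R}) (w : T) : \bar R :=
  \sum_(0 <= n <oo) (q ^+ n * X n w)%:E.

(* f and g are extended-real valued because -log P(.) is +oo on null events. *)
Definition asymp_equiv_at0 (R : realType) (f g : R -> \bar R) : Prop :=
  f eps / g eps @[eps --> (0%R : R)^'+] --> 1.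

(* Main.v *)
Require Import Defs.
From HB Require Import structures.
From mathcomp Require Import all_boot all_order all_algebra finmap.
From mathcomp Require Import all_classical all_reals all_analysis.
From mathcomp Require Import measurable_realfun.
From mathcomp Require Import ring lra.

(** Write p for the distribution function of X, b = q^(1/(1+gamma)) and
a = q^(gamma/(1+gamma)), so that q = a * b and b^gamma = a. The constant comes
from a cost minimisation. Forcing X_n <= c_n eps for all n costs about
K eps^(-gamma) \sum_n c_n^(-gamma) on the scale of -log, and it makes S <= eps
when \sum_n q^n c_n = 1. Lagrange multipliers give the optimal allocation
c_n = (1 - a) b^(-n), whose cost is K / (1 - a)^(1+gamma).

Lower bound on P(S <= eps) ([prob_geometric_series_ge]). The event contains
the intersection over all n of {X_n <= (1 - a) eps b^(-n)}, whose probability is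
an infinite product of values of p, by independence and continuity of P from
above. Indices with a small threshold are handled by the assumption on p and sum
to the geometric series found above. For the others, -log p(x) is at most a
constant times P(X > x), and \sum_m P(X > x0 b^(-m)) is finite because
log max(X, 1) is integrable ([sum_tail_prob_le]); these indices contribute a
bounded amount, negligible against eps^(-gamma).

Upper bound ([prob_geometric_series_le]). Keep only the first N terms and round
q^n X_n to a grid of mesh eps / M. If S <= eps, then one of at most (M+1)^N
cells occurs, each of them an intersection of events {X_n <= x_n}, and the cost of
every cell is bounded below by Radon's inequality ([radon_inequality]), which is
the optimality of the allocation. For fixed N and M the number of cells is
negligible on the logarithmic scale, and the bound approaches the constant as M
and then N tend to infinity.

Both halves go through intersections of half-line events, for which independence
is the product rule itself, rather than through sums of the variables. *)

Set Implicit Arguments.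
Unset Strict Implicit.
Unset Printing Implicit Defensive.

Import Order.TTheory GRing.Theory Num.Theory.
Import numFieldNormedType.Exports.

Local Open Scope classical_set_scope.
Local Open Scope ring_scope.

(** * Measurability of sublevel sets of a limit *)

Lemma einf_esup_cvg (R : realType) (u : (\bar R)^nat) :
  limn_einf u = limn_esup u -> cvgn u.
Proof.
move=> eq_lim.
have cE : esups u @ \oo --> limn_esup u.
  by rewrite limn_esup_lim; exact: is_cvg_esups.
have cI : einfs u @ \oo --> limn_esup u.
  by rewrite -eq_lim limn_einf_lim; exact: is_cvg_einfs.
apply/cvg_ex; exists (limn_esup u).
apply: (squeeze_cvge _ cI cE); near=> n; apply/andP; split.
  by apply: ereal_inf_lbound; exists n => /=.
by apply: ereal_sup_ubound; exists n => /=.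
Unshelve. all: by end_near. Qed.

(** The limit operator returns a default value at points where there is no
limit, so the sublevel set is split along the measurable set where the lower
and upper limits agree. *)
Lemma measurable_limn_le d (T : measurableType d) (R : realType)
    (f : nat -> T -> \bar R) (c : \bar R) :
  (forall n, measurable_fun setT (f n)) ->
  measurable [set w | (limn (f ^~ w) <= c)%E].
Proof.
move=> mf.
pose sup w := limn_esup (f ^~ w); pose inf w := limn_einf (f ^~ w).
have msup : measurable_fun setT sup by exact: measurable_fun_limn_esup.
have minf : measurable_fun setT inf.
  have mfN n : measurable_fun setT (fun w => - f n w)%E.
    exact: (measurableT_comp (@oppe_measurable R setT) (mf n)).
  have -> : inf = -%E \o (fun w => limn_esup (fun n => - f n w)%E).
    apply/funext => w /=.
    by rewrite -[in RHS]/(-%E \o (f ^~ w)) limn_esupN oppeK.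
  exact: measurableT_comp (@oppe_measurable R setT)
    (measurable_fun_limn_esup mfN).
pose C := [set w | inf w = sup w].
have mC : measurable C by rewrite -[C]setTI; exact: measurable_eqe.
have mD : measurable [set w | (sup w <= c)%E].
  by rewrite -[X in measurable X]setTI; exact: emeasurable_fun_infty_c.
pose dflt : set T := if (point <= c)%E then setT else set0.
have mdflt : measurable dflt by rewrite /dflt; case: ifP.
rewrite (_ : [set w | _] =
    (C `&` [set w | (sup w <= c)%E]) `|` (~` C `&` dflt)).
  by apply: measurableU; apply: measurableI => //; exact: measurableC.
apply/seteqP; split=> w /=.
  have [Cw|Cw] := pselect (C w).
    have cv := einf_esup_cvg Cw.
    by move=> lc; left; split => //; rewrite /sup is_cvg_limn_esupE.
  have dv : ~ cvgn (f ^~ w).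
    by move=> cv; apply: Cw; rewrite /C /= /inf /sup;
    rewrite is_cvg_limn_einfE // is_cvg_limn_esupE.
  by rewrite (dvgP dv) => lc; right; split => //; rewrite /dflt lc.
case=> -[Cw].
  have cv := einf_esup_cvg Cw.
  by rewrite /sup is_cvg_limn_esupE.
have dv : ~ cvgn (f ^~ w).
  by move=> cv; apply: Cw; rewrite /C /= /inf /sup;
    rewrite is_cvg_limn_einfE // is_cvg_limn_esupE.
by rewrite /dflt (dvgP dv); case: ifP.
Qed.

(** * Logarithmic asymptotics as exponential bounds *)

(** Exponentiating the two inequalities on the ratio; finiteness of the ratio is
what excludes p = 0. *)
Lemma near_one_lne_div (R : realType) (p : \bar R) (v del : R) :
  (0 <= p <= 1)%E -> 0 < v ->
  let F := ((- lne p) / v%:E)%E in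
  (F \is a fin_num /\ `|1 - fine F| <= del) <->
  ((expR (- ((1 + del) * v)))%:E <= p)%E /\
  (p <= (expR (- ((1 - del) * v)))%:E)%E.
Proof.
move=> p01 v0 F.
case: p p01 @F => [r| |]; rewrite ?leye_eq ?leeNy_eq ?andbF //.
rewrite !lee_fin => /andP[r0 _].
have [r_gt0|] := ltP 0 r; last first.
  move=> rle; have -> : r = 0 by apply/le_anti/andP.
  rewrite le0_lneNy //= inver gt_eqF //= mulyr gtr0_sg ?invr_gt0 // mul1e.
  by split => -[] //; rewrite leNgt expR_gt0.
rewrite lne_EFin // inver gt_eqF // -EFinN -EFinM /= ler_distlC.
have -> : (expR (- ((1 + del) * v)) <= r) = (- ln r / v <= 1 + del).
  by rewrite -[r in LHS]lnK // ler_expR ler_pdivrMr // lerNl.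
have -> : (r <= expR (- ((1 - del) * v))) = (1 - del <= - ln r / v).
  by rewrite -[r in LHS]lnK // ler_expR ler_pdivlMr // lerNr.
by split => [[_ /andP[]] | [-> ->]].
Qed.

(** Exponential bounds are stable under the finite products and sums of
probabilities that occur below, unlike the ratio of logarithms. *)
Lemma asymp_equiv_neg_lneP (R : realType) (p : R -> \bar R) (c g : R) :
  0 < c -> (forall e, 0 <= p e <= 1)%E ->
  asymp_equiv_at0 (fun e => - lne (p e))%E (fun e => (c * e `^ (- g))%:E) <->
  forall del, 0 < del -> \forall e \near 0^'+,
    ((expR (- ((1 + del) * (c * e `^ (- g)))))%:E <= p e)%E /\
    (p e <= (expR (- ((1 - del) * (c * e `^ (- g)))))%:E)%E.
Proof.
move=> c0 p01.
have v0 (e : R) : 0 < e -> 0 < c * e `^ (- g).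
  by move=> e0; rewrite mulr_gt0 // powR_gt0.
rewrite /asymp_equiv_at0; split=> [/fine_cvgP[ffin fcvg] del del0|bounds].
  have /cvgrPdist_le/(_ _ del0) fdel := fcvg.
  near=> e; apply/near_one_lne_div => //.
    by apply: v0; near: e; exact: nbhs_right_gt.
  by split; near: e.
apply/fine_cvgP; split.
  near=> e; have e0 : 0 < e by near: e; exact: nbhs_right_gt.
  have [] // := (near_one_lne_div 1 (p01 e) (v0 e e0)).2.
  by near: e; exact: bounds.
apply/cvgrPdist_le => del del0; near=> e.
have e0 : 0 < e by near: e; exact: nbhs_right_gt.
have [] // := (near_one_lne_div del (p01 e) (v0 e e0)).2.
by near: e; exact: bounds.
Unshelve. all: by end_near. Qed.

Lemma near0_right_ex (R : realType) (Q : R -> Prop) :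
  (\forall e \near 0^'+, Q e) ->
  exists2 x0 : R, 0 < x0 & forall x, 0 < x -> x <= x0 -> Q x.
Proof.
move=> [r /= r0 rQ]; exists (r / 2); first by rewrite divr_gt0.
move=> x x0 xr; apply: (rQ x) => //=.
rewrite sub0r normrN gtr0_norm // (le_lt_trans xr) // ltr_pdivrMr //.
by rewrite ltr_pMr // ltr1n.
Qed.

Lemma near_and (R : realType) (A B : R -> Prop) :
  (\forall e \near 0^'+, A e) -> (\forall e \near 0^'+, B e) ->
  \forall e \near 0^'+, A e /\ B e.
Proof.
by move=> nA nB; near=> e; split; near: e.
Unshelve. all: by end_near. Qed.

(** * Half-line events of an i.i.d. family *)

(** The distribution function as a real number, which keeps products and
exponential bounds out of the extended reals. *)
Definition prob_le d (T : measurableType d) (R : realType)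
    (P : probability T R) (X : {RV P >-> R}) (x : R) : R :=
  fine (P [set w | X w <= x]).

Section half_lines.
Context d (T : measurableType d) (R : realType) (P : probability T R).
Implicit Types (X : {RV P >-> R}).

Lemma rv_le_preimage X x : [set w | X w <= x] = X @^-1` `]-oo, x]%classic.
Proof. by apply/seteqP; split => w; rewrite /= in_itv. Qed.

Lemma measurable_rv_le X x : measurable [set w | X w <= x].
Proof. by rewrite rv_le_preimage; exact: measurable_funPTI. Qed.

Lemma prob_leE X x : P [set w | X w <= x] = (prob_le X x)%:E.
Proof. by rewrite fineK // fin_num_measure //; exact: measurable_rv_le. Qed.

Lemma prob_le_ge0 X x : 0 <= prob_le X x.
Proof. by rewrite -lee_fin -prob_leE. Qed.

Lemma prob_le_le1 X x : prob_le X x <= 1.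
Proof. by rewrite -lee_fin -prob_leE; exact/probability_le1/measurable_rv_le. Qed.

Lemma prob_le_mono X : {homo prob_le X : x y / x <= y}.
Proof.
move=> x y xy; rewrite -lee_fin -!prob_leE le_measure ?inE //;
  try exact: measurable_rv_le.
by move=> w /= /le_trans; apply.
Qed.

Variables (X : {RV P >-> R}) (Xs : nat -> {RV P >-> R}).
Hypothesis X_iid : iid (oapp Xs X).

Lemma iid_prob_le_prod (c : nat -> R) (N : nat) :
  P [set w | forall i, (i < N)%N -> Xs i w <= c i] =
  (\prod_(i < N) prob_le X (c i))%:E.
Proof.
have [indep ident] := X_iid.
pose A (i : option nat) := `]-oo, oapp c 0 i]%classic : set R.
pose s := [seq Some i | i <- iota 0 N].
have us : uniq s by rewrite map_inj_uniq ?iota_uniq // => i j [].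
have := indep (seq_fset tt s) A (fun=> measurable_itv _).
rewrite (_ : \bigcap_(i in _) _ =
    [set w | forall i, (i < N)%N -> Xs i w <= c i]).
  move=> ->; rewrite (perm_big s); last first.
    by rewrite -[X in perm_eq _ X](undup_id us) seq_fset_perm.
  rewrite big_map -{1}[N]subn0 -/(index_iota 0 N) big_mkord -prodEFin.
  apply: eq_bigr => i _; rewrite -prob_leE rv_le_preimage.
  by have := ident (Some (i : nat)) None _ (measurable_itv `]-oo, c i]%R).
apply/seteqP; split => w h i.
  move=> iN.
  have iS : Some i \in seq_fset tt s by rewrite seq_fsetE map_f // mem_iota.
  by have := h _ iS; rewrite /A /= in_itv.
rewrite -[X in X -> _]/(is_true (i \in seq_fset tt s)) seq_fsetE => /mapP[j].
by rewrite mem_iota => jN ->; rewrite /A /= in_itv /=; exact: h.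
Qed.

End half_lines.

(** * Inequalities for powers and geometric sums *)

Lemma powR_lt1 (R : realType) (q r : R) : 0 < q < 1 -> 0 < r -> 0 < q `^ r < 1.
Proof.
move=> /andP[q0 q1] r0; rewrite powR_gt0 //=.
by have := gt0_ltr_powR r0 _ _ q1; rewrite powR1; apply; rewrite nnegrE ?ltW.
Qed.

Section real_inequalities.
Context {R : realType}.
Implicit Types (a b g x y : R).

(** The graph of the convex function x |-> x^(-g) lies above its tangent at 1. *)
Lemma powRN_tangent g x : 0 <= g -> 0 < x -> 1 - g * (x - 1) <= x `^ (- g).
Proof.
move=> g0 x0; rewrite /powR gt_eqF // mulNr.
apply: le_trans (expR_ge1Dx _); rewrite lerD2l lerN2 ler_wpM2l //.
by rewrite -[x in ln x](subrKC 1) ?le_ln1Dx // ltrBrDr addNr.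
Qed.

(** Up to normalisation, term i is the tangent inequality at the point where
y i is proportional to t i, and the linear parts add up to a constant. Read with
sum y fixed, it says that the cost \sum t^(1+g) y^(-g) is minimal for the
allocation y proportional to t. *)
Lemma radon_inequality (I : finType) g (t y : I -> R) :
  0 < g -> (forall i, 0 < t i) -> (forall i, 0 < y i) ->
  (\sum_i t i) `^ (1 + g) * (\sum_i y i) `^ (- g) <=
  \sum_i t i `^ (1 + g) * y i `^ (- g).
Proof.
move=> g0 t0 y0; set A := \sum_i t i; set s := \sum_i y i.
have [I0|/card_gt0P[i0 _]] := posnP #|I|.
  rewrite /A !big_pred0; try by move=> i; have := card0_eq I0 i.
  by rewrite powR0 ?mul0r // gt_eqF // addr_gt0.
have sumr_gt0 (h : I -> R) : (forall i, 0 < h i) -> 0 < \sum_i h i.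
  move=> h0; rewrite (bigD1 i0) //= ltr_pwDl // sumr_ge0 // => i _.
  exact: ltW.
have A0 : 0 < A by exact: sumr_gt0.
have s0 : 0 < s by exact: sumr_gt0.
have powR1D x : 0 < x -> x `^ (1 + g) = x * x `^ g.
  by move=> x0; rewrite powRD ?(gt_eqF x0) ?implybT // powRr1 // ltW.
have powRV x : 0 < x -> x^-1 `^ g = (x `^ g)^-1.
  by move=> x0; rewrite -powR_inv1 ?ltW // -powRrM mulN1r powRN.
pose c := A `^ g * s `^ (- g).
have c0 : 0 < c by rewrite mulr_gt0 // powR_gt0.
have term i : c * (t i + g * t i - g * (y i * (A / s))) <=
    t i `^ (1 + g) * y i `^ (- g).
  have ti0 := t0 i; have yi0 := y0 i.
  have x0 : 0 < y i * A / (t i * s) by rewrite divr_gt0 ?mulr_gt0.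
  have := powRN_tangent (ltW g0) x0.
  rewrite -(ler_pM2l (mulr_gt0 c0 (t0 i))) => le1.
  have -> : t i `^ (1 + g) * y i `^ (- g) =
      c * t i * (y i * A / (t i * s)) `^ (- g).
    have tg0 := powR_gt0 g ti0; have yg0 := powR_gt0 g yi0.
    have Ag0 := powR_gt0 g A0; have sg0 := powR_gt0 g s0.
    rewrite powR1D // /c !powRN powRM ?invr_ge0 ?ltW ?mulr_gt0 // powRM ?ltW //.
    rewrite powRV ?mulr_gt0 // powRM ?ltW //.
    by field; rewrite !gt_eqF.
  apply: le_trans le1; rewrite le_eqVlt; apply/orP; left; apply/eqP.
  field.
  by rewrite !gt_eqF.
apply: le_trans; last exact: (ler_sum _ (fun i _ => term i)).
rewrite -mulr_sumr sumrB big_split /= -!mulr_sumr -mulr_suml -/A -/s.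
rewrite powR1D // /c le_eqVlt; apply/orP; left; apply/eqP.
by field; rewrite gt_eqF.
Qed.

Lemma count_multiples_lt b y (N : nat) : 0 < b -> 0 <= y ->
  \sum_(m < N) ((m%:R * b < y)%R%:R : R) <= 1 + y / b.
Proof.
move=> b0; elim: N y => [|N IHN] y y0.
  by rewrite big_ord0 addr_ge0 // divr_ge0 // ltW.
rewrite big_ord_recl mul0r.
have [yb|by_] := ltP y b.
  rewrite big1 ?addr0 => [|i _].
    by rewrite (le_trans (_ : _ <= 1)) ?lerDl ?divr_ge0 ?(ltW b0) // lern1 leq_b1.
  rewrite (_ : _ < y = false) //; apply/negbTE; rewrite -leNgt.
  rewrite (le_trans (ltW yb)) // ler_peMl ?(ltW b0) // ler1n.
  by [].
have -> : 1 + y / b = 1 + (1 + (y - b) / b) by field; rewrite gt_eqF.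
apply: lerD; first by rewrite lern1 leq_b1.
have yb0 : 0 <= y - b by rewrite subr_ge0.
apply: le_trans (IHN _ yb0).
apply: ler_sum => i _; rewrite lift0 -natr1 mulrDl mul1r.
by rewrite ltrBrDr.
Qed.

(** This is -ln p <= (1 - p) / p, from 1 + u <= exp u at u = (1 - p) / p. *)
Lemma le_expR_div (p0 p : R) : 0 < p0 -> p0 <= p -> p <= 1 ->
  expR (- ((1 - p) / p0)) <= p.
Proof.
move=> p00 p0p p1; have p_gt0 : 0 < p by exact: lt_le_trans p0p.
rewrite expRN -[leRHS]invrK lef_pV2 ?posrE ?invr_gt0 ?expR_gt0 //.
have -> : p^-1 = 1 + (1 - p) / p by field; rewrite gt_eqF.
apply: le_trans (expR_ge1Dx _) _; rewrite ler_expR ler_wpM2l ?subr_ge0 //.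
by rewrite lef_pV2.
Qed.

Lemma near0_powRN_ge g c B : 0 < g -> 0 < c ->
  \forall e \near 0^'+, B <= c * e `^ (- g).
Proof.
move=> g0 c0.
have /cvgr_dist_lt/(_ (c / (`|B| + 1))) := @powR_cvg0 R _ g0.
rewrite divr_gt0 // ?ltr_wpDl // => /(_ isT) small.
near=> e; have e0 : 0 < e by near: e; exact: nbhs_right_gt.
have : `|0 - e `^ g| < c / (`|B| + 1) by near: e.
rewrite sub0r normrN ger0_norm ?powR_ge0 // ltr_pdivlMr ?ltr_wpDl // => lt.
rewrite powRN ler_pdivlMr ?powR_gt0 // mulrC (le_trans _ (ltW lt)) //.
by rewrite ler_wpM2l ?powR_ge0 // (le_trans (ler_norm B)) // lerDl.
Unshelve. all: by end_near. Qed.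

End real_inequalities.

Lemma geometric_sum_le (R : realType) (a : R) (N : nat) : 0 < a < 1 ->
  \sum_(n < N) a ^+ n <= (1 - a)^-1.
Proof.
move=> /andP[a0 a1].
have := subrX1 a N; rewrite -[in RHS]opprB mulNr => /eqP.
rewrite -eqr_oppLR opprB => /eqP eq.
rewrite -[leRHS]mul1r ler_pdivlMr ?subr_gt0 // mulrC -eq.
by rewrite lerBlDr lerDl exprn_ge0 // ltW.
Qed.

Lemma exists_geometric_sum_powR_ge (R : realType) (a r s : R) :
  0 < a < 1 -> 0 < r < 1 -> 0 < s ->
  exists2 N : nat, (0 < N)%N &
    r / (1 - a) `^ s <= (\sum_(n < N) a ^+ n) `^ s.
Proof.
move=> /andP[a0 a1] r01 s0; have /andP[r0 _] := r01.
have /andP[u0 u1] : 0 < r `^ s^-1 < 1 by rewrite powR_lt1 // invr_gt0.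
have a_lt1 : `|a| < 1 by rewrite gtr0_norm.
have a1' : 0 < 1 - a by rewrite subr_gt0.
have /cvgr_dist_lt/(_ (1 - r `^ s^-1)) := cvg_geometric 1 a_lt1.
rewrite subr_gt0 => /(_ u1) small.
have [N [N0]] : exists N, (0 < N)%N /\ `|0 - geometric 1 a N| < 1 - r `^ s^-1.
  near \oo => N; exists N; split; last by near: N.
  by near: N; exact: nbhs_infty_gt.
rewrite /geometric /= mul1r sub0r normrN ger0_norm ?exprn_ge0 ?(ltW a0) // => aN.
exists N => //.
have -> : \sum_(n < N) a ^+ n = (1 - a ^+ N) / (1 - a).
  have := subrX1 a N => eq; apply: (canRL (mulfK _)); first by rewrite gt_eqF.
  by rewrite mulrC -opprB mulNr -eq opprB.
have u_le : r `^ s^-1 <= 1 - a ^+ N by rewrite lerBrDr -lerBrDl ltW.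
have r_le : r <= (1 - a ^+ N) `^ s.
  have := ge0_ler_powR (ltW s0) _ _ u_le.
  rewrite -powRrM mulVf ?gt_eqF // powRr1 ?(ltW r0) //.
  by apply; rewrite nnegrE // (le_trans (ltW u0)).
rewrite powRM ?invr_ge0 ?(ltW a1') ?(le_trans (ltW u0)) //.
rewrite -[(1 - a)^-1]powR_inv1 ?(ltW a1') // -powRrM mulN1r powRN.
by rewrite ler_pM2r // invr_gt0 powR_gt0.
Unshelve. all: by end_near. Qed.

Lemma exists_grid_size (R : realType) (g r : R) (N : nat) :
  0 < r < 1 -> 0 < g ->
  exists2 M : nat, (0 < M)%N & r <= (1 + N%:R / M%:R) `^ (- g).
Proof.
move=> r01 g0; have /andP[r0 _] := r01.
have /andP[u0 u1] : 0 < r `^ g^-1 < 1 by rewrite powR_lt1 // invr_gt0.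
set u := (r `^ g^-1)^-1.
have u_gt1 : 1 < u by rewrite invf_gt1.
exists (Num.trunc (N%:R / (u - 1))).+1 => //.
set M := _.+1.
have NM : N%:R / M%:R <= u - 1.
  rewrite ler_pdivrMr // mulrC -ler_pdivrMr ?subr_gt0 //.
  have /truncn_itv/andP[_ /ltW //] : 0 <= N%:R / (u - 1).
  by rewrite divr_ge0 // subr_ge0 ltW.
have le_u : 1 + N%:R / M%:R <= u by rewrite -lerBrDl.
have gt0 : 0 < 1 + N%:R / M%:R :> R by rewrite ltr_pwDl // divr_ge0.
rewrite powRN -[r]invrK lef_pV2 ?posrE ?powR_gt0 ?invr_gt0 //.
have -> : r^-1 = u `^ g.
  rewrite /u -powRN -powRrM mulNr mulVf ?gt_eqF // powR_inv1 //; exact: ltW.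
by rewrite ge0_ler_powR ?nnegrE ?(ltW g0) ?(ltW gt0) // (le_trans ler01) // ltW.
Qed.

(** * Tail probabilities under a logarithmic moment *)

(** The number of indices m with X > x0 b^(-m) is at most a constant plus a
multiple of log max(X, 1); integrating gives a bound uniform in N. *)
Lemma sum_tail_prob_le d (T : measurableType d) (R : realType)
    (P : probability T R) (X : {RV P >-> R}) (b x0 : R) :
  0 < b < 1 -> 0 < x0 ->
  ('E_P[fun w => ln (Num.max (X w) 1)%R] < +oo)%E ->
  exists D, forall N, \sum_(m < N) (1 - prob_le X (x0 * b ^- m)) <= D.
Proof.
move=> /andP[b0 b1] x00 Efin.
have beta0 : 0 < - ln b by rewrite oppr_gt0 ln_lt0 // b0.
pose L w := ln (Num.max (X w) 1).
have L0 w : 0 <= L w by rewrite ln_ge0 // le_max lexx orbT.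
have mL : measurable_fun setT L.
  apply: (measurableT_comp (@measurable_ln R)).
  by apply: measurable_maxr => //; exact: measurable_funPT.
pose c := 1 + `|ln x0| / - ln b.
have c0 : 0 <= c by rewrite addr_ge0 // divr_ge0 // ltW.
pose bound w := c + L w / - ln b.
have intL : (\int[P]_w (L w)%:E < +oo)%E by move: Efin; rewrite unlock.
have mLb : measurable_fun setT (fun w => (L w / - ln b)%:E).
  by apply/measurable_EFinP; exact: measurable_funM.
have int_fin : (\int[P]_w (bound w)%:E)%E \is a fin_num.
  rewrite ge0_fin_numE; last first.
    by apply: integral_ge0 => w _; rewrite lee_fin addr_ge0 // divr_ge0 // ltW.
  under eq_integral do rewrite EFinD.
  rewrite ge0_integralD //=; last by move=> w _; rewrite lee_fin divr_ge0 // ltW.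
  apply: lte_add_pinfty.
    by rewrite integral_cst //= probability_setT mule1 ltry.
  under eq_integral do rewrite EFinM.
  rewrite ge0_integralZr //; last 3 first.
  - exact/measurable_EFinP.
  - by move=> w _; rewrite lee_fin.
  - by rewrite lee_fin invr_ge0 ltW.
  rewrite muleC lte_mul_pinfty // ?lee_fin ?invr_ge0 ?ltW //.
exists (fine (\int[P]_w (bound w)%:E)%E) => N.
rewrite -lee_fin fineK // -sumEFin.
pose A (m : nat) := [set w | x0 * b ^- m < X w].
have AE m : A m = ~` [set w | X w <= x0 * b ^- m].
  by apply/seteqP; split => w; rewrite /A /= ltNge => /negP.
have mA m : measurable (A m) by rewrite AE; apply/measurableC/measurable_rv_le.
have PA m : (1 - prob_le X (x0 * b ^- m))%:E = (\int[P]_w (\1_(A m) w)%:E)%E.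
  rewrite integral_indic // setIT.
  have := probability_setC P (measurable_rv_le X (x0 * b ^- m)).
  by rewrite prob_leE -AE => /esym.
under eq_bigr do rewrite PA.
rewrite -ge0_integral_sum //; last first.
  by move=> m; apply/measurable_EFinP; exact: measurable_indic.
apply: ge0_le_integral => //.
- by move=> w _; apply: sume_ge0 => m _; rewrite lee_fin.
- apply: emeasurable_sum => m; apply/measurable_EFinP.
  exact: measurable_indic.
- apply/measurable_EFinP; apply: measurable_funD => //.
  exact: measurable_funM.
move=> w _; rewrite sumEFin lee_fin.
apply: le_trans (_ : _ <= 1 + (`|ln x0| + L w) / - ln b) _; last first.
  by rewrite /bound /c mulrDl addrA.
apply: le_trans (count_multiples_lt N beta0 _); last by rewrite addr_ge0.
apply: ler_sum => m _; rewrite indicE ler_nat.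
have [/set_mem Aw|//] := boolP (w \in A m).
suff -> : m%:R * - ln b < `|ln x0| + L w by [].
have xm0 : 0 < x0 * b ^- m by rewrite divr_gt0 // exprn_gt0.
have : ln (x0 * b ^- m) < L w.
  rewrite ltr_ln ?posrE ?lt_max ?ltr01 ?orbT //.
  by rewrite Aw.
rewrite lnM ?posrE ?invr_gt0 ?exprn_gt0 // lnV ?posrE ?exprn_gt0 // lnXn //.
have := ler_norm (- ln x0); rewrite normrN -mulr_natl; lra.
Qed.

(** * Events of the geometric series and of products of half-lines *)

(** By induction on N, since dividing x by b shifts the thresholds by one. While
x stays below x0 the factor p(x) is controlled by the exponential bound; once x
exceeds x0, every remaining threshold x b^(-n) exceeds x0 b^(-n), and the
remaining factors are controlled by the tails of X. The tail sum restarts at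
index 0 at each step, which costs nothing because its terms are nonnegative. *)
Lemma prod_prob_le_ge d (T : measurableType d) (R : realType)
    (P : probability T R) (X : {RV P >-> R}) (b g k x0 : R) :
  0 < b < 1 -> 0 <= k -> 0 < x0 -> 0 < prob_le X x0 ->
  (forall x, 0 < x -> x <= x0 -> expR (- (k * x `^ (- g))) <= prob_le X x) ->
  forall (N : nat) (x : R), 0 < x ->
  expR (- (k * x `^ (- g) * (\sum_(n < N) (b `^ g) ^+ n) +
           (\sum_(m < N) (1 - prob_le X (x0 * b ^- m))) / prob_le X x0)) <=
  \prod_(n < N) prob_le X (x * b ^- n).
Proof.
move=> /andP[b0 b1] k0 x00 p0 small N; elim: N => [|N IHN] x x_gt0.
  by rewrite !big_ord0 mulr0 mul0r addr0 oppr0 expR0.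
have bX_ge1 n : 1 <= b ^- n.
  by rewrite invr_ge1 ?unitfE ?gt_eqF ?exprn_gt0 // exprn_ile1 // ltW.
(* For x0 <= x all the factors are bounded at once by the tails. *)
have [xx0|x0x] := ltP x x0; last first.
  apply: (@le_trans _ _ (\prod_(n < N.+1)
    expR (- ((1 - prob_le X (x0 * b ^- n)) / prob_le X x0)))).
    rewrite -expR_sum ler_expR sumrN lerN2 -mulr_suml lerDr.
    rewrite mulr_ge0 ?mulr_ge0 ?powR_ge0 // sumr_ge0 // => n _.
    by rewrite exprn_ge0 ?powR_ge0.
  apply: ler_prod => n _; rewrite expR_ge0 /=.
  apply: (@le_trans _ _ (prob_le X (x0 * b ^- n))).
    apply: le_expR_div => //; last exact: prob_le_le1.
    apply: prob_le_mono.
    by rewrite ler_peMr // ltW.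
  by apply: prob_le_mono; rewrite ler_wpM2r // (le_trans ler01).
rewrite big_ord_recl expr0 invr1 mulr1.
have -> : \prod_(i < N) prob_le X (x * b ^- bump 0 i) =
    \prod_(i < N) prob_le X ((x / b) * b ^- i).
  by apply: eq_bigr => i _; rewrite /bump add1n exprS invfM mulrA.
have xb0 : 0 < x / b by rewrite divr_gt0.
apply: le_trans (ler_pM (expR_ge0 _) (expR_ge0 _)
  (small x x_gt0 (ltW xx0)) (IHN _ xb0)).
rewrite -expRD ler_expR -opprD lerN2 addrA; apply: lerD.
  have -> : (x / b) `^ (- g) = x `^ (- g) * b `^ g.
    rewrite powRM ?invr_ge0 ?ltW // -[b^-1]powR_inv1 ?ltW // -powRrM.
    by rewrite mulN1r opprK.
  rewrite big_ord_recl expr0 [leRHS]mulrDr mulr1 lerD2l -!mulrA.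
  rewrite !ler_wpM2l ?powR_ge0 // mulr_sumr; apply: ler_sum => i _.
  by rewrite lift0 exprS.
rewrite ler_pM2r ?invr_gt0 // big_ord_recr /= lerDl subr_ge0.
exact: prob_le_le1.
Qed.

Section geometric_series_events.
Context d (T : measurableType d) (R : realType) (P : probability T R).
Variables (X : {RV P >-> R}) (Xs : nat -> {RV P >-> R}).
Hypothesis X_iid : iid (oapp Xs X).

Lemma iid_prob_le_all_ge (c : nat -> R) (r : R) :
  (forall N, r <= \prod_(n < N) prob_le X (c n)) ->
  (r%:E <= P [set w | forall n, (Xs n w <= c n)%R])%E.
Proof.
move=> prod_ge.
pose F N := [set w | forall n, (n < N)%N -> Xs n w <= c n].
have mF N : measurable (F N).
  have -> : F N = \bigcap_(n in `I_N) [set w | Xs n w <= c n].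
    by apply/seteqP; split => w h n; exact: (h n).
  by apply: bigcap_measurableType => n _; exact: measurable_rv_le.
have FE : [set w | forall n, Xs n w <= c n] = \bigcap_N F N.
  apply/seteqP; split => w; first by move=> h N _ n _; exact: h.
  by move=> h n; exact: (h n.+1).
have : P (F N) @[N --> \oo] --> P (\bigcap_N F N).
  apply: nonincreasing_cvg_mu => //.
  - by rewrite (le_lt_trans (probability_le1 P (mF _))) ?ltry.
  - exact: bigcapT_measurable.
  - move=> m n mn; apply/subsetPset => w h i im; apply: h.
    exact: leq_trans mn.
rewrite FE => FP; rewrite -(cvg_lim _ FP) //.
apply: lime_ge; first by apply/cvg_ex; eexists; exact: FP.
by apply: nearW => N; rewrite (iid_prob_le_prod X_iid) lee_fin.
Qed.

Lemma geometric_series_le (q : R) (c : nat -> R) (e : R) (w : T) :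
  0 < q -> (forall n, 0 <= Xs n w) -> (forall n, Xs n w <= c n) ->
  (forall N, \sum_(n < N) q ^+ n * c n <= e) ->
  (geometric_series q Xs w <= e%:E)%E.
Proof.
move=> q0 X0 Xc ce; apply: lime_le.
  by apply: is_cvg_nneseries => n _ _;
    rewrite lee_fin mulr_ge0 ?exprn_ge0 ?(ltW q0).
apply: nearW => N; rewrite sumEFin lee_fin big_mkord; apply: le_trans (ce N).
by apply: ler_sum => n _; rewrite ler_wpM2l ?exprn_ge0 ?(ltW q0).
Qed.

Lemma measurable_geometric_series_le (q e : R) :
  measurable [set w | (geometric_series q Xs w <= e%:E)%E].
Proof.
apply: measurable_limn_le => N.
apply: emeasurable_sum => n; apply/measurable_EFinP.
by apply: measurable_funM => //; exact: measurable_funPT.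
Qed.

(** The set where some Xs n is negative is a countable union of null sets, so it
can be added to B for free. *)
Lemma le_prob_ae_nonneg (A B : set T) :
  (forall n, {ae P, forall w, 0 <= Xs n w}) ->
  measurable A -> measurable B ->
  (forall w, (forall n, 0 <= Xs n w) -> A w -> B w) ->
  (P A <= P B)%E.
Proof.
move=> X0 mA mB AB.
pose Z := \bigcup_n [set w | Xs n w < 0].
have ZE n : [set w | Xs n w < 0] = Xs n @^-1` `]-oo, 0[%classic.
  by apply/seteqP; split => w; rewrite /= in_itv.
have mZn n : measurable [set w | Xs n w < 0].
  by rewrite ZE; exact: measurable_funPTI.
have mZ : measurable Z by exact: bigcupT_measurable.
have PZ : P Z = 0%E.
  apply/eqP; rewrite -measure_le0.
  apply: le_trans (generalized_Boole_inequality P mZn mZ) _.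
  rewrite eseries0 // => n _ _.
  apply: measure_negligible; first exact: mZn.
  apply: negligibleS (X0 n) => w /=.
  by move=> neg pos; move: neg; rewrite ltNge pos.
rewrite -(measureU0 mB mZ PZ) le_measure ?inE //; first exact: measurableU.
move=> w Aw; have [neg|nneg] := pselect (Z w); [by right|left].
apply: AB => // n; rewrite leNgt; apply/negP => lt0.
by apply: nneg; exists n.
Qed.

End geometric_series_events.

(** * Lower bound on the small-ball probability *)

Section lower_bound.
Context d (T : measurableType d) (R : realType) (P : probability T R).
Variables (X : {RV P >-> R}) (Xs : nat -> {RV P >-> R}) (q g : R).
Hypothesis X_iid : iid (oapp Xs X).
Hypothesis X_ge0 : forall i : option nat, {ae P, forall w, 0 <= oapp Xs X i w}.
Hypotheses (q01 : 0 < q < 1) (g0 : 0 < g).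

Let a := q `^ (g / (1 + g)).
Let b := q `^ (1 + g)^-1.

Let g1 : 0 < 1 + g. Proof. by rewrite addr_gt0. Qed.
Let q0 : 0 < q. Proof. by have /andP[] := q01. Qed.
Let a01 : 0 < a < 1. Proof. by rewrite powR_lt1 // divr_gt0. Qed.
Let b01 : 0 < b < 1. Proof. by rewrite powR_lt1 // invr_gt0. Qed.

Let powR_bg : b `^ g = a.
Proof. by rewrite /a /b -powRrM mulrC. Qed.

Let q_div_b : q / b = a.
Proof.
rewrite /a /b -{1}[q]powRr1 ?ltW // -powRN -powRD; last first.
  by rewrite (gt_eqF q0) implybT.
by congr (_ `^ _); field; rewrite gt_eqF.
Qed.

(** The thresholds (1 - a) e b^(-n) are the optimal allocation: their weighted
sum is (1 - a) e \sum_n a^n = e. *)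
Lemma prob_geometric_series_ge (k x0 D : R) :
  0 <= k -> 0 < x0 -> 0 < prob_le X x0 ->
  (forall x, 0 < x -> x <= x0 -> expR (- (k * x `^ (- g))) <= prob_le X x) ->
  (forall N, \sum_(m < N) (1 - prob_le X (x0 * b ^- m)) <= D) ->
  forall e, 0 < e ->
  ((expR (- (k / (1 - a) `^ (1 + g) * e `^ (- g) + D / prob_le X x0)))%:E <=
   P [set w | geometric_series q Xs w <= e%:E])%E.
Proof.
move=> k0 x00 p0 small tailD e e0.
have [a0 a1] := andP a01; have [b0 b1] := andP b01.
have a1' : 0 < 1 - a by rewrite subr_gt0.
pose c n := (1 - a) * e * b ^- n.
have ce N : \sum_(n < N) q ^+ n * c n <= e.
  have -> : \sum_(n < N) q ^+ n * c n = (1 - a) * e * \sum_(n < N) a ^+ n.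
    rewrite mulr_sumr; apply: eq_bigr => n _.
    by rewrite /c mulrCA; congr (_ * _); rewrite -q_div_b expr_div_n.
  by rewrite mulrAC ger_pMl // -ler_pdivlMl // mulr1 geometric_sum_le.
have prodc N : expR (- (k / (1 - a) `^ (1 + g) * e `^ (- g) + D / prob_le X x0))
    <= \prod_(n < N) prob_le X (c n).
  have x0' : 0 < (1 - a) * e by rewrite mulr_gt0.
  apply: le_trans (prod_prob_le_ge b01 k0 x00 p0 small N x0').
  rewrite ler_expR lerN2 powR_bg; apply: lerD; last first.
    by rewrite ler_pM2r ?invr_gt0.
  apply: (@le_trans _ _ (k * ((1 - a) * e) `^ (- g) * (1 - a)^-1)).
    by rewrite ler_wpM2l ?geometric_sum_le // mulr_ge0 // powR_ge0.
  rewrite powRM ?(ltW a1') ?(ltW e0) // powRD; last by rewrite (gt_eqF a1') implybT.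
  rewrite powRr1 ?(ltW a1') // !powRN le_eqVlt; apply/orP; left; apply/eqP.
  by field; rewrite !gt_eqF ?powR_gt0.
have mc : measurable [set w | forall n, Xs n w <= c n].
  have -> : [set w | forall n, Xs n w <= c n] =
      \bigcap_n [set w | Xs n w <= c n].
    by apply/seteqP; split => w h n; [move=> _|]; exact: h.
  by apply: bigcapT_measurable => n; exact: measurable_rv_le.
apply: le_trans (iid_prob_le_all_ge X_iid prodc) _.
apply: (@le_prob_ae_nonneg _ _ _ _ Xs) => //.
- by move=> n; exact: (X_ge0 (Some n)).
- exact: measurable_geometric_series_le.
- by move=> w X0 Xc; exact: (@geometric_series_le _ _ _ _ _ _ c).
Qed.

End lower_bound.

(** * Upper bound on the small-ball probability *)

Lemma measure_bigsetU_le d (T : measurableType d) (R : realType)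
    (mu : measure T R) (I : Type) (s : seq I) (Q : pred I) (F : I -> set T) :
  (forall i, measurable (F i)) ->
  (mu (\big[setU/set0]_(i <- s | Q i) F i) <= \sum_(i <- s | Q i) mu (F i))%E.
Proof.
move=> mF; elim: s => [|i s IHs]; first by rewrite !big_nil measure0.
rewrite !big_cons; case: ifP => // _.
apply: le_trans (leeD2l _ IHs).
by apply: measureU2 => //; exact: bigsetU_measurable.
Qed.

Section upper_bound.
Context d (T : measurableType d) (R : realType) (P : probability T R).
Variables (X : {RV P >-> R}) (Xs : nat -> {RV P >-> R}) (q g : R).
Hypothesis X_iid : iid (oapp Xs X).
Hypothesis X_ge0 : forall i : option nat, {ae P, forall w, 0 <= oapp Xs X i w}.
Hypotheses (q01 : 0 < q < 1) (g0 : 0 < g).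

Let a := q `^ (g / (1 + g)).
Let q0 : 0 < q. Proof. by have /andP[] := q01. Qed.

Variables (N M : nat) (e : R).
Hypotheses (N0 : (0 < N)%N) (M0 : (0 < M)%N) (e0 : 0 < e).

(** The weighted variable q^n X_n is allotted k_n + 1 mesh units e / M, one more
than its integer part, so that a cell is an intersection of half-lines. *)
Let grid (k : N.-tuple 'I_M.+1) (n : nat) : R :=
  (nth ord0 k n).+1%:R / M%:R * e * q ^- n.

Let cell k := [set w | forall n, (n < N)%N -> Xs n w <= grid k n].

Let M0' : 0 < M%:R :> R. Proof. by rewrite ltr0n. Qed.

(** Take for k_n the integer part of q^n X_n M / e. These integer parts add up to
at most M because the first N terms of the series add up to at most e. *)
Lemma grid_cover (w : T) :
  (forall n, 0 <= Xs n w) -> (geometric_series q Xs w <= e%:E)%E ->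
  exists2 k : N.-tuple 'I_M.+1, (\sum_(n < N) tnth k n <= M)%N & cell k w.
Proof.
move=> X0 Se.
pose z n := q ^+ n * Xs n w * M%:R / e.
have z0 n : 0 <= z n.
  by rewrite divr_ge0 ?(ltW e0) // !mulr_ge0 ?exprn_ge0 // ltW.
have sum_z : \sum_(n < N) z n <= M%:R.
  rewrite -!mulr_suml mulrAC ler_piMl ?(ltW M0') // ler_pdivrMr // mul1r.
  rewrite -lee_fin -sumEFin (le_trans _ Se) //.
  rewrite -(big_mkord xpredT (fun n => (q ^+ n * Xs n w)%:E)).
  apply: nneseries_lim_ge => n _ _.
  by rewrite lee_fin mulr_ge0 ?exprn_ge0 // ltW.
have truncz n : (Num.trunc (z n))%:R <= z n by rewrite truncn_le.
have zM (n : 'I_N) : (Num.trunc (z n) <= M)%N.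
  rewrite -(ler_nat R) (le_trans (truncz n)) // (le_trans _ sum_z) //.
  by rewrite (bigD1 n) //= lerDl sumr_ge0.
exists [tuple inord (Num.trunc (z n)) | n < N].
  rewrite -(ler_nat R) natr_sum (le_trans _ sum_z) // ler_sum // => n _.
  by rewrite tnth_mktuple inordK ?ltnS.
move=> n nN; rewrite /grid -(tnth_nth _ _ (Ordinal nN)) tnth_mktuple /=.
rewrite inordK ?ltnS ?(zM (Ordinal nN)) //.
have /andP[_ /ltW] := truncn_itv (z0 n).
rewrite ler_pdivrMr // => zle.
set t := (_.+1%:R : R) in zle *.
have -> : t / M%:R * e / q ^+ n = t * e / (q ^+ n * M%:R).
  by field; rewrite !gt_eqF ?exprn_gt0.
by rewrite ler_pdivlMr ?mulr_gt0 ?exprn_gt0 // mulrCA mulrA.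
Qed.

(** Radon's inequality with t_n = a^n and y_n = (k_n + 1) / M; rounding up N
terms makes the sum of the y_n at most 1 + N / M instead of 1. *)
Lemma prob_cell_le (k0 x0 : R) (k : N.-tuple 'I_M.+1) :
  0 <= k0 ->
  (forall x, 0 < x -> x <= x0 -> prob_le X x <= expR (- (k0 * x `^ (- g)))) ->
  M.+1%:R / M%:R * e * q ^- N <= x0 ->
  (\sum_(n < N) tnth k n <= M)%N ->
  (P (cell k) <= (expR (- (k0 * ((\sum_(n < N) a ^+ n) `^ (1 + g) *
     (1 + N%:R / M%:R) `^ (- g)) * e `^ (- g))))%:E)%E.
Proof.
move=> k00 small ex0 sumk.
rewrite (iid_prob_le_prod X_iid) lee_fin.
have grid0 n : 0 < grid k n.
  by rewrite /grid divr_gt0 ?exprn_gt0 // mulr_gt0 // divr_gt0.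
apply: (@le_trans _ _ (\prod_(n < N) expR (- (k0 * (grid k n) `^ (- g))))).
  apply: ler_prod => n _; rewrite prob_le_ge0 /=; apply: small => //.
  apply: le_trans ex0; rewrite /grid ler_pM //.
  - by rewrite mulr_ge0 ?divr_ge0 // ltW.
  - by rewrite invr_ge0 exprn_ge0 // ltW.
  - rewrite ler_pM2r // ler_pM2r ?invr_gt0 // ler_nat.
    exact: ltn_ord.
  - have /andP[_ q1] := q01.
    by rewrite lef_pV2 ?posrE ?exprn_gt0 // ler_wiXn2l ?(ltW q0) ?(ltW q1) // ltnW.
rewrite -expR_sum ler_expR sumrN lerN2 -mulr_sumr -mulrA ler_wpM2l //.
pose y (n : 'I_N) : R := (tnth k n).+1%:R / M%:R.
have y0 n : 0 < y n by rewrite divr_gt0.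
have sumy : \sum_n y n <= 1 + N%:R / M%:R.
  rewrite -mulr_suml ler_pdivrMr // mulrDl mul1r divfK ?gt_eqF //.
  under eq_bigr do rewrite -natr1.
  by rewrite big_split /= sumr_const card_ord lerD2r -natr_sum ler_nat.
have sumy0 : 0 < \sum_n y n.
  rewrite (bigD1 (Ordinal N0)) //= ltr_pwDl // sumr_ge0 // => n _; exact: ltW.
have a0 : 0 < a by rewrite powR_gt0.
(* The weight q^(n g) equals (a^n)^(1+g). *)
have gridE (n : 'I_N) : grid k n `^ (- g) =
    e `^ (- g) * ((a ^+ n) `^ (1 + g) * y n `^ (- g)).
  have qn0 : 0 < q ^+ n by rewrite exprn_gt0.
  have -> : grid k n = e * y n * (q ^+ n)^-1.
    by rewrite /grid /y -tnth_nth (mulrC e).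
  rewrite powRM ?invr_ge0 ?mulr_ge0 ?(ltW qn0) ?(ltW e0) ?(ltW (y0 n)) //.
  rewrite powRM ?(ltW e0) ?(ltW (y0 n)) // -!mulrA; congr (_ * _).
  have -> : (q ^+ n)^-1 `^ (- g) = q `^ (n%:R * g).
    rewrite -[q ^+ n]powR_mulrn ?(ltW q0) // -[X in X `^ _]powRN -powRrM.
    by rewrite mulNr mulrN opprK.
  have -> : (a ^+ n) `^ (1 + g) = q `^ (n%:R * g).
    rewrite -[a ^+ n]powR_mulrn ?(ltW a0) // -!powRrM.
    by congr (_ `^ _); field; rewrite gt_eqF // addr_gt0.
  by rewrite mulrC.
under [leRHS]eq_bigr do rewrite gridE.
rewrite -mulr_sumr mulrC ler_wpM2l ?powR_ge0 //.
apply: le_trans; last first.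
  by apply: radon_inequality => // n; rewrite exprn_gt0.
rewrite ler_wpM2l ?powR_ge0 // !powRN lef_pV2 ?posrE ?powR_gt0 //.
by rewrite ge0_ler_powR ?nnegrE ?(ltW g0) ?(ltW sumy0) // (le_trans (ltW sumy0)).
Qed.

(** Union bound over the (M+1)^N cells. *)
Lemma prob_geometric_series_le (k0 x0 : R) :
  0 <= k0 ->
  (forall x, 0 < x -> x <= x0 -> prob_le X x <= expR (- (k0 * x `^ (- g)))) ->
  M.+1%:R / M%:R * e * q ^- N <= x0 ->
  (P [set w | geometric_series q Xs w <= e%:E] <=
   ((M.+1 ^ N)%:R * expR (- (k0 * ((\sum_(n < N) a ^+ n) `^ (1 + g) *
     (1 + N%:R / M%:R) `^ (- g)) * e `^ (- g))))%:E)%E.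
Proof.
move=> k00 small ex0.
have mcell k : measurable (cell k).
  have -> : cell k = \bigcap_(n in `I_N) [set w | Xs n w <= grid k n].
    by apply/seteqP; split => w h n; exact: (h n).
  by apply: bigcap_measurableType => n _; exact: measurable_rv_le.
pose good (k : N.-tuple 'I_M.+1) := (\sum_(n < N) tnth k n <= M)%N.
apply: (@le_trans _ _ (P (\big[setU/set0]_(k | good k) cell k))).
  apply: (@le_prob_ae_nonneg _ _ _ _ Xs).
  - by move=> n; exact: (X_ge0 (Some n)).
  - exact: measurable_geometric_series_le.
  - exact: bigsetU_measurable.
  move=> w X0 /(grid_cover X0)[k goodk cellk].
  by rewrite (bigD1 k) //=; left.
apply: le_trans (measure_bigsetU_le _ _ _ mcell) _.
apply: (@le_trans _ _ (\sum_(k : N.-tuple 'I_M.+1)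
    (expR (- (k0 * ((\sum_(n < N) a ^+ n) `^ (1 + g) *
     (1 + N%:R / M%:R) `^ (- g)) * e `^ (- g))))%:E)%E).
  rewrite big_mkcond; apply: lee_sum => k _; case: ifP => [goodk|_].
    exact: (prob_cell_le k00 small ex0 goodk).
  by rewrite lee_fin expR_ge0.
rewrite sumEFin sumr_const card_tuple card_ord lee_fin.
by rewrite [leRHS]mulr_natl.
Qed.

End upper_bound.

(** * The asymptotics *)

Theorem theorem8 (d : measure_display) (T : measurableType d) (R : realType)
    (P : probability T R) (q : R) (X : {RV P >-> R}) (Xs : nat -> {RV P >-> R})
    (gamma K : R) :
  0 < q < 1 ->
  (* the family X, X_0, X_1, ... indexed by option nat, with None for X *)
  iid (oapp Xs X) ->
  (forall i : option nat, {ae P, forall w, 0 <= oapp Xs X i w}) ->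
  ('E_P[fun w => ln (Num.max (X w) 1)%R] < +oo)%E ->
  0 < gamma -> 0 < K ->
  asymp_equiv_at0 (fun eps => - lne (P [set w | (X w <= eps)%R]))%E
    (fun eps => (K * eps `^ (- gamma))%:E) ->
  asymp_equiv_at0
    (fun eps => - lne (P [set w | geometric_series q Xs w <= eps%:E]))%E
    (fun eps => (K / (1 - q `^ (gamma / (1 + gamma))) `^ (1 + gamma)
                 * eps `^ (- gamma))%:E).
Proof.
move=> q01 X_iid X_ge0 Elog g0 K0 asympX.
have g1 : 0 < 1 + gamma by rewrite addr_gt0.
have b01 : 0 < q `^ (1 + gamma)^-1 < 1 by rewrite powR_lt1 // invr_gt0.
have a01 : 0 < q `^ (gamma / (1 + gamma)) < 1 by rewrite powR_lt1 // divr_gt0.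
have /andP[_ a1] := a01.
have Z0 : 0 < (1 - q `^ (gamma / (1 + gamma))) `^ (1 + gamma).
  by rewrite powR_gt0 // subr_gt0.
set c := K / _.
have c0 : 0 < c by rewrite divr_gt0.
have boundX del : 0 < del -> exists2 x0, 0 < x0 &
    forall x, 0 < x -> x <= x0 ->
    expR (- ((1 + del) * K * x `^ (- gamma))) <= prob_le X x /\
    prob_le X x <= expR (- ((1 - del) * K * x `^ (- gamma))).
  move=> del0; have p01 e : (0 <= P [set w | (X w <= e)%R] <= 1)%E.
    by rewrite measure_ge0 probability_le1 //; exact: measurable_rv_le.
  have near_bnd := (asymp_equiv_neg_lneP gamma K0 p01).1 asympX del del0.
  have [x0 x00 bnd] := near0_right_ex near_bnd.
  exists x0 => // x x_gt0 /(bnd x x_gt0).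
  by rewrite prob_leE !lee_fin !mulrA.
apply/asymp_equiv_neg_lneP => //.
  move=> e; rewrite measure_ge0 probability_le1 //.
  exact: measurable_geometric_series_le.
move=> del del0.
apply: near_and.
(* Half of the slack del pays for the bound on X, the other half for the
   bounded contribution of the tails. *)
- have del20 : 0 < del / 2 by rewrite divr_gt0.
  have [x0 x00 bndX] := boundX _ del20.
  have p0 : 0 < prob_le X x0.
    by apply: lt_le_trans (bndX x0 x00 (lexx _)).1; exact: expR_gt0.
  have [D tailD] := sum_tail_prob_le b01 x00 Elog.
  have k0 : 0 <= (1 + del / 2) * K by rewrite mulr_ge0 ?addr_ge0 // ltW.
  have small x : 0 < x -> x <= x0 ->
    expR (- ((1 + del / 2) * K * x `^ (- gamma))) <= prob_le X x.
    by move=> x_gt0 /(bndX x x_gt0)[].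
  near=> e; have e0 : 0 < e by near: e; exact: nbhs_right_gt.
  apply: le_trans (prob_geometric_series_ge X_iid X_ge0 q01 g0 k0 x00 p0
    small tailD e0).
  rewrite lee_fin ler_expR lerN2.
  have : D / prob_le X x0 <= del / 2 * c * e `^ (- gamma).
    by near: e; apply: near0_powRN_ge => //; rewrite mulr_gt0.
  by rewrite -[_ * K / _]mulrA -/c; lra.
(* A factor r is lost four times: in the bound on X, in the choices of N and M,
   and in absorbing the number of cells. *)
pose dl := Num.min del 1; pose r := 1 - dl / 4.
have dl0 : 0 < dl by rewrite lt_min del0 ltr01.
have dl1 : dl <= 1 by rewrite ge_min lexx orbT.
have dl_del : dl <= del by rewrite ge_min lexx.
have r01 : 0 < r < 1 by rewrite /r; apply/andP; split; lra.
have /andP[r0 r1] := r01.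
have r4 : 1 - del <= r ^+ 4.
  have sq : (1 - dl / 4) ^+ 2 >= 1 - dl / 2 by rewrite expr2; nra.
  have sq4 : (1 - dl / 2) ^+ 2 >= 1 - dl by rewrite expr2; nra.
  have half0 : 0 <= 1 - dl / 2 by lra.
  have -> : r ^+ 4 = (r ^+ 2) ^+ 2 by rewrite -exprM.
  apply: le_trans (_ : (1 - dl / 2) ^+ 2 <= _); first lra.
  by rewrite lerXn2r ?nnegrE ?exprn_ge0 // ltW.
have r_del0 : 0 < 1 - r by rewrite subr_gt0.
have [x0 x00 bndX] := boundX _ r_del0.
have [N N0 N_large] := exists_geometric_sum_powR_ge a01 r01 g1.
have [M M0 M_large] := exists_grid_size N r01 g0.
have k0 : 0 <= r * K by rewrite mulr_ge0 // ltW.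
have small x : 0 < x -> x <= x0 ->
    prob_le X x <= expR (- (r * K * x `^ (- gamma))).
  by move=> x_gt0 /(bndX x x_gt0)[_]; rewrite subKr.
have q0 : 0 < q by have /andP[] := q01.
have qN0 : 0 < q ^+ N by rewrite exprn_gt0.
have MM0 : 0 < M.+1%:R / M%:R :> R by rewrite divr_gt0 ?ltr0n.
near=> e; have e0 : 0 < e by near: e; exact: nbhs_right_gt.
have ex0 : M.+1%:R / M%:R * e * q ^- N <= x0.
  rewrite ler_pdivrMr // -ler_pdivlMl //.
  near: e; apply: nbhs_right_le.
  by rewrite mulr_gt0 ?invr_gt0 // mulr_gt0.
apply: le_trans (prob_geometric_series_le X_iid X_ge0 q01 g0 N0 M0 e0 k0
  small ex0) _.
have MN0 : 0 < (M.+1 ^ N)%:R :> R by rewrite ltr0n expn_gt0.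
rewrite -[(M.+1 ^ N)%:R]lnK // -expRD lee_fin ler_expR.
have absorb : ln (M.+1 ^ N)%:R <= (r ^+ 3 - r ^+ 4) * c * e `^ (- gamma).
  near: e; apply: near0_powRN_ge => //; rewrite mulr_gt0 // subr_gt0.
  by rewrite [X in X < _]exprS gtr_pMl ?exprn_gt0.
have main : r ^+ 3 * c * e `^ (- gamma) <= r * K *
    ((\sum_(n < N) (q `^ (gamma / (1 + gamma))) ^+ n) `^ (1 + gamma) *
     (1 + N%:R / M%:R) `^ (- gamma)) * e `^ (- gamma).
  rewrite ler_wpM2r ?powR_ge0 //.
  have -> : r ^+ 3 * c =
      r * K * (r / (1 - q `^ (gamma / (1 + gamma))) `^ (1 + gamma) * r).
    by rewrite /c; field; rewrite gt_eqF.
  rewrite ler_wpM2l // ler_pM // ?(ltW r0) //.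
  by rewrite divr_ge0 // ltW.
have : (1 - del) * c * e `^ (- gamma) <= r ^+ 4 * c * e `^ (- gamma).
  by rewrite ler_wpM2r ?powR_ge0 // ler_wpM2r // ltW.
rewrite mulrA; lra.
Unshelve. all: by end_near. Qed.
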